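(* Let $(\alpha_n)_{n\in\mathbb{N}_0}$ be a sequence of positive real numbers with $\inf_n \alpha_n>0$, and let $\delta(0)=(\delta_n(0))_{n\in\mathbb{N}_0}\in\ell^2(\mathbb{N}_0)$. Consider the system $$\frac{d\delta_n}{d\tau}=-\alpha_n\,\delta_n,\qquad n\in\mathbb{N}_0,\ \tau\ge 0,$$ with initial data $\delta(0)$. Then the system admits a unique global solution $\delta\in C^\infty([0,\infty),\ell^2(\mathbb{N}_0))$, and the amplitudes $C_n(\tau):=\pi+\delta_n(\tau)$ satisfy $$\lim_{\tau\to\infty}C_n(\tau)=\pi\qquad\text{for all } n\in\mathbb{N}_0.$$ Moreover, $\delta(\tau)$ converges to $0$ exponentially in the norm of $\ell^2$ as $\tau\to\infty$, and the energy $$\mathcal{E}(\tau):=\sum_{n=0}^\infty\frac{\alpha_n}{2}\,\delta_n(\tau)^2$$ is strictly decreasing and satisfies $$\mathcal{E}(\tau)\le \mathcal{E}(0)\,e^{-2(\inf_n\alpha_n)\,\tau}.$$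
   Context: $\mathbb{N}_0=\{0,1,2,\dots\}$ and $\ell^2(\mathbb{N}_0)$ is the real Hilbert space of square-summable sequences. The amplitudes $C_n(\tau)$ evolve in the affine space $\pi+\ell^2(\mathbb{N}_0)$, and $\delta_n(\tau)=C_n(\tau)-\pi$ are their deviations from the constant profile $\pi$.
   Formalization: Smoothness into ℓ² up to τ=0 is claimed only if (α_n^k δ_n(0)) is in ℓ² for all k (else false: α_n=n+1, δ_n(0)=1/(n+1)); otherwise continuity on [0,∞) and smoothness on (0,∞). Strict energy decrease is claimed only for δ(0)≠0. Energy may be +∞ at τ=0. *)

(* Defs.v *)
From HB Require Import structures.
From mathcomp Require Import all_boot all_order all_algebra.
From mathcomp Require Import all_classical all_reals all_analysis.

Set Implicit Arguments.
Unset Strict Implicit.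
Unset Printing Implicit Defensive.

Import Order.TTheory GRing.Theory Num.Theory.
Import numFieldNormedType.Exports.

Local Open Scope classical_set_scope.
Local Open Scope ring_scope.

(* The library's space of L^2 functions for the counting measure on nat. No
   quotient is needed: counting-a.e. equality on nat is equality. The library
   gives it a linear structure but no norm; the norm is added below. *)
Definition ell2 (R : realType) : Type :=
  LfunType (@counting nat R) (lee1n 2).

Section ell2_norm.
Variable R : realType.

HB.instance Definition _ := GRing.Lmodule.on (ell2 R).

Definition ell2_fun (f : ell2 R) : nat -> R :=
  (f : LfunType (@counting nat R) (lee1n 2)).

Definition ell2_norm (f : ell2 R) : R :=
  fine ('N[@counting nat R]_2%:R%:E [EFin \o ell2_fun f])%E.

Lemma ell2_normD (f g : ell2 R) :
  ell2_norm (f + g) <= ell2_norm f + ell2_norm g.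
Proof. exact: (@ler_LnormD _ _ _ _ _ (lee1n 2) f g). Qed.

Lemma ell2_normZ (a : R) (f : ell2 R) :
  ell2_norm (a *: f) = `|a| * ell2_norm f.
Proof.
rewrite /ell2_norm.
have -> : EFin \o ell2_fun (a *: f) = EFin \o (a \*: ell2_fun f) by [].
have := @LnormZ _ _ _ (@counting nat R) _ (lee1n 2) f a.
rewrite -/(ell2_fun f) => ->.
by rewrite -(@finite_norm_fine _ _ _ (@counting nat R) _ (lee1n 2) f).
Qed.

Lemma ell2_norm_sqr (f : ell2 R) :
  (ell2_norm f ^+ 2)%:E = (\sum_(n <oo) (ell2_fun f n ^+ 2)%:E)%E.
Proof.
rewrite EFin_expe /ell2_norm.
rewrite (@finite_norm_fine _ _ _ (@counting nat R) _ (lee1n 2) f).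
rewrite Lnorm_counting ?ltr0n//.
set S := (X in ((X `^ _) ^+ 2)%E).
have S0 : (0 <= S)%E by apply: nneseries_ge0 => n _ _; exact: poweR_ge0.
have -> : ((S `^ 2%:R^-1) ^+ 2 = S)%E.
  have half : 2%:R^-1 + 2%:R^-1 = 1 :> R by rewrite [RHS]splitr mul1r.
  by rewrite expe2 -poweRD ?half ?poweRe1// /poweRD_def half oner_eq0.
apply: eq_eseriesr => n _ /=.
by rewrite powR_mulrn// real_normK ?num_real.
Qed.

Lemma ell2_norm_eq0 (f : ell2 R) : ell2_norm f = 0 -> f = 0.
Proof.
move=> f0; apply/LfuneqP => n; apply/eqP; rewrite -sqrf_eq0 eq_le sqr_ge0 andbT.
rewrite -lee_fin; have := ell2_norm_sqr f; rewrite f0 expr0n/= => ->.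
rewrite (@nneseriesD1 _ _ n)//; last by move=> k _; rewrite lee_fin sqr_ge0.
by rewrite leeDl// nneseries_ge0// => k _ _; rewrite lee_fin sqr_ge0.
Qed.

HB.instance Definition _ := @Lmodule_isNormed.Build R (ell2 R)
  ell2_norm ell2_normD ell2_normZ ell2_norm_eq0.

End ell2_norm.

Coercion ell2_fun : ell2 >-> Funclass.

(* f has derivative l at x relative to I (one-sided at an endpoint of I). *)
Definition has_derive_within (R : realType) (V : normedModType R) (I : set R)
    (f : R -> V) (x : R) (l : V) : Prop :=
  (fun s => (s - x)^-1 *: (f s - f x)) @ within I x^' --> l.

(* C^oo(I, V): D k is the k-th derivative of f on I; differentiability of every
   D k makes every D k continuous on I. *)
Definition smooth_on (R : realType) (V : normedModType R) (I : set R)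
    (f : R -> V) : Prop :=
  exists D : nat -> R -> V,
    (forall x, I x -> D 0%N x = f x) /\
    (forall k x, I x -> has_derive_within I (D k) x (D k.+1 x)).

(* The values of a solution at negative times are irrelevant. *)
Definition global_solution (R : realType) (alpha : nat -> R)
    (delta0 : ell2 R) (delta : R -> ell2 R) : Prop :=
  delta 0 = delta0 /\
  forall n tau, 0 <= tau ->
    has_derive_within `[0, +oo[ (fun s => delta s n) tau
      (- alpha n * delta tau n).

(* Compatibility of the data with smoothness up to time 0: delta0 lies in the
   domain of every power of the diagonal operator diag(alpha_n) on ell2. It
   holds for every delta0 when alpha is bounded. *)
Definition smooth_data (R : realType) (alpha : nat -> R)
    (delta0 : ell2 R) : Prop :=
  forall k : nat,
    (fun n => alpha n ^+ k * delta0 n) \in Lfun (@counting nat R) 2%:R%:E.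

Definition amplitude (R : realType) (delta : R -> ell2 R) (n : nat)
    (tau : R) : R := pi + delta tau n.

Definition exponentially_to_0 (R : realType) (V : normedModType R)
    (f : R -> V) : Prop :=
  exists M c : R, 0 < c /\
    forall tau, 0 <= tau -> `|f tau| <= M * expR (- c * tau).

(* Extended-real valued: for unbounded alpha the energy may be +oo at time 0. *)
Definition energy (R : realType) (alpha : nat -> R) (u : ell2 R) : \bar R :=
  (\sum_(n <oo) (alpha n / 2 * u n ^+ 2)%:E)%E.

(* Main.v *)
Require Import Defs.
From mathcomp Require Import all_boot all_order all_algebra.
From mathcomp Require Import all_classical all_reals all_analysis.
From mathcomp Require Import ring lra.
Import Order.TTheory GRing.Theory Num.Theory.
Import numFieldNormedType.Exports.
Local Open Scope classical_set_scope.
Local Open Scope ring_scope.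

(* The system decouples: delta_n(t) = exp(-alpha_n t) delta_n(0), with k-th
   derivative (-alpha_n)^k exp(-alpha_n t) delta_n(0). For t > 0 the factor
   alpha_n^k exp(-alpha_n t) is at most k! / t^k, so all these sequences lie in
   ell2. The first-order Taylor remainder on [s0, oo) is bounded coordinatewise
   by (s - x)^2 alpha_n^(k+2) exp(-alpha_n s0) |delta_n(0)|, which makes the
   coordinatewise derivative a derivative in norm; for data in the domain of all
   powers of diag(alpha_n) the choice s0 = 0 is allowed. Continuity at 0 for
   general data follows by splitting off the tail of delta(0). Uniqueness holds
   in each coordinate since exp(alpha_n t) delta_n(t) has zero derivative, and
   the energy estimates hold term by term; the energy is finite for t > 0 as
   2 alpha_n t <= exp(2 alpha_n t). *)

(** * Square-summable sequences and domination in [ell2] *)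

(* Junk value 0 when f is not square-summable. *)
Definition to_ell2 {R : realType} (f : nat -> R) : ell2 R :=
  insubd (0 : LfunType (@counting nat R) (lee1n 2)) f.

Lemma to_ell2E {R : realType} (f : nat -> R) (n : nat) :
  f \in Lfun (@counting nat R) 2%:R%:E -> to_ell2 f n = f n.
Proof. by move=> fL; rewrite /to_ell2 /ell2_fun insubdK. Qed.

Lemma Lfun2_countingP {R : realType} (f : nat -> R) :
  f \in Lfun (@counting nat R) 2%:R%:E <->
  (\sum_(n <oo) (f n ^+ 2)%:E < +oo)%E.
Proof.
have sqE : (\sum_(n <oo) (f n ^+ 2)%:E =
            \sum_(n <oo) `|(EFin \o f) n| `^ 2%:R)%E.
  apply: eq_eseriesr => n _ /=.
  by rewrite powR_mulrn// real_normK ?num_real.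
rewrite sqE; split=> [fL|ffin].
  have /andP[_] := fL; rewrite inE /= /finite_norm Lnorm_counting ?ltr0n//.
  by apply: lty_poweRy; rewrite invr_eq0 pnatr_eq0.
apply/andP; split; first by rewrite inE.
by rewrite inE /= /finite_norm Lnorm_counting ?ltr0n//; exact: poweR_lty.
Qed.

Lemma ell2_in_Lfun {R : realType} (u : ell2 R) :
  (u : nat -> R) \in Lfun (@counting nat R) 2%:R%:E.
Proof. exact: (@LfunP _ _ _ _ _ (lee1n 2) u). Qed.

Lemma Lfun2_dominated {R : realType} (c : R) (f g : nat -> R) :
  (forall n, `|f n| <= c * `|g n|) ->
  g \in Lfun (@counting nat R) 2%:R%:E -> f \in Lfun (@counting nat R) 2%:R%:E.
Proof.
move=> fg /Lfun2_countingP gfin; apply/Lfun2_countingP.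
apply: (@le_lt_trans _ _ ((c ^+ 2)%:E * \sum_(n <oo) (g n ^+ 2)%:E)%E).
  rewrite -nneseriesZl; last by move=> n _; rewrite lee_fin sqr_ge0.
  apply: lee_nneseries => [n _ _|n _]; first by rewrite lee_fin sqr_ge0.
  rewrite -EFinM lee_fin -exprMn -(real_normK (num_real (f n))).
  rewrite -(real_normK (num_real (c * g n))) ler_pXn2r ?nnegrE//.
  by rewrite normrM (le_trans (fg n))// ler_wpM2r// ler_norm.
apply: lte_mul_pinfty => //; first by rewrite lee_fin sqr_ge0.
Qed.

Lemma ell2_normr_sqr {R : realType} (u : ell2 R) :
  (`|u| ^+ 2)%:E = (\sum_(n <oo) (u n ^+ 2)%:E)%E.
Proof. exact: ell2_norm_sqr. Qed.

Lemma ell2_norm_dominated {R : realType} (c : R) (u v : ell2 R) : 0 <= c ->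
  (forall n, `|u n| <= c * `|v n|) -> `|u| <= c * `|v|.
Proof.
move=> c0 uv; rewrite -(@ler_pXn2r _ 2%N)// ?nnegrE ?mulr_ge0//.
rewrite exprMn -lee_fin [leRHS]EFinM.
rewrite !ell2_normr_sqr.
rewrite -nneseriesZl; last by move=> n _; rewrite lee_fin sqr_ge0.
apply: lee_nneseries => [n _ _|n _]; first by rewrite lee_fin sqr_ge0.
rewrite -EFinM lee_fin -exprMn -(real_normK (num_real (u n))).
rewrite -(real_normK (num_real (c * v n))) ler_pXn2r ?nnegrE//.
by rewrite normrM (ger0_norm c0).
Qed.

Lemma ell2_addE {R : realType} (u v : ell2 R) n :
  ell2_fun (u + v) n = u n + v n.
Proof. by []. Qed.

Lemma ell2_oppE {R : realType} (u : ell2 R) n : ell2_fun (- u) n = - u n.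
Proof. by []. Qed.

Lemma ell2_scaleE {R : realType} a (u : ell2 R) n :
  ell2_fun (a *: u) n = a * u n.
Proof. by []. Qed.

(** * Elementary inequalities for the exponential *)

(** Convexity: the tangent bound [1 + x <= expR x], rescaled, is used once at [p] and once at
    [q]. *)
Lemma expR_tangent {R : realType} (p q : R) :
  (q - p) * expR p <= expR q - expR p <= (q - p) * expR q.
Proof.
have tangent x y : (y - x) * expR x <= expR y - expR x :> R.
  have -> : expR y = expR (y - x) * expR x by rewrite -expRD subrK.
  by have := expR_ge1Dx (y - x); have := expR_gt0 x; nra.
by rewrite tangent/=; have := tangent q p; lra.
Qed.

Lemma expR_sub_le {R : realType} (p q M : R) : expR p <= M -> expR q <= M ->
  `|expR q - expR p| <= `|q - p| * M.
Proof.
move=> pM qM; have /andP[lo hi] := expR_tangent p q.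
have p0 := expR_gt0 p; have q0 := expR_gt0 q.
by case: (ler0P (q - p)) => d0; case: (ler0P (expR q - expR p)) => e0; nra.
Qed.

(** By the two tangent bounds the remainder lies between 0 and [(q - p) * (expR q - expR p)]; the
    Lipschitz bound on the second factor supplies the other power of [q - p]. *)
Lemma expR_taylor1_le {R : realType} (p q M : R) :
  expR p <= M -> expR q <= M ->
  `|expR q - expR p - (q - p) * expR p| <= (q - p) ^+ 2 * M.
Proof.
move=> pM qM; have /andP[lo hi] := expR_tangent p q.
rewrite ger0_norm ?subr_ge0//.
apply: (@le_trans _ _ ((q - p) * (expR q - expR p))); first by lra.
rewrite (le_trans (ler_norm _))// normrM -(real_normK (num_real (q - p))).
by rewrite expr2 -mulrA ler_wpM2l// expR_sub_le.
Qed.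

(** * Derivatives relative to a set *)

(** After division by [s - x] the remainder is at most [C * |s - x|], which tends to 0. *)
Lemma has_derive_within_quadratic {R : realType} (V : normedModType R)
    (I : set R) (f : R -> V) (x C : R) (l : V) :
  (\forall s \near x, I s -> `|f s - f x - (s - x) *: l| <= C * (s - x) ^+ 2) ->
  has_derive_within I f x l.
Proof.
move=> fC; apply/cvgrPdist_le => e e0.
(* [C] may have any sign; [|C| + 1] is a positive bound by which one can divide. *)
have C0 : 0 < `|C| + 1 by rewrite ltr_pwDr.
rewrite near_withinE near_withinE.
near=> s => sx Is.
have sx0 : s - x != 0 by rewrite subr_eq0.
have -> : l - (s - x)^-1 *: (f s - f x) =
    - ((s - x)^-1 *: (f s - f x - (s - x) *: l)).
  by rewrite [in RHS]scalerBr scalerA mulVf// scale1r opprB.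
rewrite normrN normrZ normfV ler_pdivrMl ?normr_gt0//.
have h : `|f s - f x - (s - x) *: l| <= C * (s - x) ^+ 2.
  by move: Is; near: s.
apply: (le_trans h); rewrite -(real_normK (num_real (s - x))).
rewrite expr2 mulrCA ler_wpM2l//.
apply: (@le_trans _ _ ((`|C| + 1) * `|s - x|)).
  by rewrite ler_wpM2r// (le_trans (ler_norm _))// lerDl.
rewrite mulrC -ler_pdivlMr// distrC.
near: s; apply: cvgr_dist_le; first exact: cvg_id.
by rewrite divr_gt0.
Unshelve. all: by end_near. Qed.

(** Off [x], [f s] is [f x] plus [s - x] times the difference quotient, so it tends to [f x]. *)
Lemma has_derive_within_continuous {R : realType} (V : normedModType R)
    (I : set R) (f : R -> V) (x : R) (l : V) :
  has_derive_within I f x l -> f @ within I (nbhs x) --> f x.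
Proof.
move=> fl.
have idx : ((s - x) @[s --> within I x^'] --> (0 : R)).
  rewrite -(subrr x); apply: cvgB; last exact: cvg_cst.
  by move=> P xP; apply: cvg_within; exact: nbhs_dnbhs.
have fx : f @ within I x^' --> f x.
  have : (s - x) *: ((s - x)^-1 *: (f s - f x)) + f x
      @[s --> within I x^'] --> 0 *: l + f x.
    by apply: cvgD; [exact: cvgZ|exact: cvg_cst].
  rewrite scale0r add0r.
  apply: cvg_trans; apply: near_eq_cvg.
  rewrite near_withinE near_withinE.
  near=> s => sx _; rewrite /= scalerA mulfV ?subr_eq0// scale1r.
  by rewrite [LHS]subrK.
(* Passage from the punctured to the full neighbourhood: at [s = x] itself the value is [f x]. *)
move=> P /= fxP; have := fx P fxP; rewrite /= !near_simpl !near_withinE => h.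
near=> s => Is; have [->|sx] := eqVneq s x; first exact: nbhs_singleton.
by move: Is; move: sx; near: s.
Unshelve. all: by end_near. Qed.

(** Near an interior point the restriction to [I] is vacuous, and the substitution [h = s - x]
    yields the usual two-sided quotient. *)
Lemma has_derive_within_is_derive {R : realType}
    (I : set R) (f : R -> R) (x : R) (l : R) :
  I° x -> has_derive_within I f x l -> is_derive x 1 f l.
Proof.
move=> Ix fl.
have fl0 : (fun h => h^-1 *: ((f \o shift x) (h *: (1 : R)) - f x)) @ 0^' --> l.
  apply/cvgrPdist_le => e e0.
  have /cvgrPdist_le/(_ _ e0) := fl; rewrite near_withinE near_withinE => h.
  have {}h : \forall s \near x, s != x ->
      `|l - (s - x)^-1 *: (f s - f x)| <= e.
    by apply: filterS2 h Ix => s + Is sx; apply.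
  rewrite near_withinE.
  have [d /= d0 dh] := h.
  exists d => //= y /=; rewrite /ball/= sub0r normrN => yd y0.
  rewrite [_ *: 1]mulr1 /shift -[in y^-1](addrK x y).
  apply: dh; last by rewrite -subr_eq0 addrK.
  by rewrite /ball /= opprD addrCA subrr addr0 normrN.
by apply: DeriveDef; [apply/cvg_ex; exists l|exact: cvg_lim fl0].
Qed.

(** * Tails of a sequence in [ell2] *)

Definition ell2_tail {R : realType} (u : ell2 R) (N : nat) : ell2 R :=
  to_ell2 (fun n => if (n < N)%N then 0 else u n).

Lemma ell2_tailE {R : realType} (u : ell2 R) (N n : nat) :
  ell2_tail u N n = if (n < N)%N then 0 else u n.
Proof.
rewrite to_ell2E//; apply: (@Lfun2_dominated _ 1) (ell2_in_Lfun u) => k.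
by rewrite mul1r; case: ifP => _ //; rewrite normr0.
Qed.

Lemma ell2_tail_small {R : realType} (u : ell2 R) (e : R) :
  0 < e -> exists N, `|ell2_tail u N| <= e.
Proof.
move=> e0; have /Lfun2_countingP fin := ell2_in_Lfun u.
have tail0 := nneseries_tail_cvg fin
  (fun n _ => (sqr_ge0 (u n) : (0 <= (u n ^+ 2)%:E)%E)).
have /fine_cvgP[ffin /cvgr0Pnorm_le/(_ _ (exprn_gt0 2 e0)) small] := tail0.
have [N _ /(_ N (leqnn N))[/= Nfin Nsmall]] := filterI ffin small.
exists N; rewrite -(@ler_pXn2r _ 2%N)// ?nnegrE ?(ltW e0)// -lee_fin.
rewrite ell2_normr_sqr.
apply: (@le_trans _ _ (\sum_(N <= k <oo) (u k ^+ 2)%:E)%E); last first.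
  by rewrite -(fineK Nfin) lee_fin; exact: le_trans (ler_norm _) Nsmall.
(* The series started at [N] becomes a series over all indices with zero terms below [N], ready for
   a termwise comparison. *)
rewrite [leRHS]eseries_cond [leRHS]eseries_mkcond.
apply: lee_nneseries => [n _ _|n _]; first by rewrite lee_fin sqr_ge0.
by rewrite ell2_tailE; case: ltnP => _ //; rewrite expr0n.
Qed.

(** * The explicit solution: regularity in time and decay of the norm *)

Section decay.
Context {R : realType} (alpha : nat -> R) (delta0 : ell2 R).
Hypothesis alpha_gt0 : forall n, 0 < alpha n.

Definition decay_seq (k : nat) (t : R) (n : nat) : R :=
  (- alpha n) ^+ k * expR (- alpha n * t) * delta0 n.

(** The junk value 0 can occur for [t < 0], and also at [t = 0] when [k > 0], since [alpha] may be
    unbounded. *)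
Definition decay (k : nat) (t : R) : ell2 R := to_ell2 (decay_seq k t).

Let L2 := Lfun (@counting nat R) 2%:R%:E.

Lemma expR_decay_le1 (n : nat) (t : R) : 0 <= t -> expR (- alpha n * t) <= 1.
Proof. by move=> t0; rewrite expR_le1 mulNr oppr_le0 mulr_ge0// ltW. Qed.

(** The term [(a * t) ^+ k / k!] of the exponential series is at most [expR (a * t)]. *)
Lemma decay_coef_le (k : nat) (a t : R) : 0 < a -> 0 < t ->
  `|(- a) ^+ k * expR (- a * t)| <= k`!%:R / t ^+ k.
Proof.
move=> a0 t0; have at0 : 0 < a * t by rewrite mulr_gt0.
rewrite normrM normrX normrN (gtr0_norm a0) (gtr0_norm (expR_gt0 _)).
rewrite mulNr expRN ler_pdivrMr ?expR_gt0// mulrAC ler_pdivlMr ?exprn_gt0//.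
(* [expR_ge1Dxn] gives only terms of positive degree, so degree 0 is treated apart. *)
rewrite -exprMn; case: k => [|k].
  by rewrite expr0 fact0 mul1r -expR0 ler_expR ltW.
rewrite -ler_pdivrMl ?ltr0n ?fact_gt0//.
by apply: le_trans (expR_ge1Dxn k (ltW at0)); rewrite mulrC lerDr.
Qed.

Lemma decay_seq_Lfun (k : nat) (t : R) : 0 < t -> decay_seq k t \in L2.
Proof.
move=> t0; apply: (@Lfun2_dominated _ (k`!%:R / t ^+ k)) (ell2_in_Lfun delta0).
by move=> n; rewrite /decay_seq normrM ler_wpM2r// decay_coef_le.
Qed.

Lemma decay_seq0_Lfun (t : R) : 0 <= t -> decay_seq 0 t \in L2.
Proof.
move=> t0; apply: (@Lfun2_dominated _ 1) (ell2_in_Lfun delta0) => n.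
rewrite /decay_seq expr0 mul1r normrM ler_wpM2r// (gtr0_norm (expR_gt0 _)).
exact: expR_decay_le1.
Qed.

Lemma decay_seq_Lfun_data (k : nat) (t : R) :
  smooth_data alpha delta0 -> 0 <= t -> decay_seq k t \in L2.
Proof.
move=> data t0; apply: (@Lfun2_dominated _ 1) (data k) => n.
rewrite /decay_seq mul1r !normrM ler_wpM2r// !normrX normrN.
rewrite ler_piMr ?exprn_ge0// (gtr0_norm (expR_gt0 _)).
exact: expR_decay_le1.
Qed.

(** On times from [s0] on, every factor [expR (- alpha n * s)] is largest at [s0]. The second
    derivative of [decay k] is thus dominated, coordinate by coordinate, by its values at [s0],
    whose [ell2] norm is the quadratic constant. *)
Lemma decay_has_derive (I : set R) (s0 x : R) (k : nat) :
  (forall j s, s0 <= s -> decay_seq j s \in L2) ->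
  s0 <= x -> (\forall s \near x, I s -> s0 <= s) ->
  has_derive_within I (decay k) x (decay k.+1 x).
Proof.
move=> fin s0x Is0.
apply: (@has_derive_within_quadratic _ _ _ _ _ `|decay k.+2 s0|).
apply: filterS Is0 => s + Is => /(_ Is) s0s; rewrite mulrC.
apply: ell2_norm_dominated; first exact: sqr_ge0.
move=> n; rewrite !ell2_addE !ell2_oppE ell2_scaleE.
rewrite !to_ell2E ?fin// /decay_seq.
set a := alpha n; have a0 : 0 < a := alpha_gt0 n.
have expM y : s0 <= y -> expR (- a * y) <= expR (- a * s0).
  by move=> s0y; rewrite ler_expR !mulNr lerN2 ler_pM2l.
have := expR_taylor1_le _ _ _ (expM _ s0x) (expM _ s0s).
(* Factoring out [(- a) ^+ k] leaves the scalar remainder for [p = - a * x] and [q = - a * s]; its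
   [(q - p) ^+ 2] contributes the [a ^+ 2] that turns [k] into [k.+2]. *)
have -> : (- a) ^+ k * expR (- a * s) * delta0 n -
    (- a) ^+ k * expR (- a * x) * delta0 n -
    (s - x) * ((- a) ^+ k.+1 * expR (- a * x) * delta0 n) =
    (- a) ^+ k * (expR (- a * s) - expR (- a * x) -
      (- a * s - - a * x) * expR (- a * x)) * delta0 n.
  by rewrite exprS; ring.
have normk j : `|(- a) ^+ j| = a ^+ j by rewrite normrX normrN gtr0_norm.
move=> h; rewrite 2!normrM [X in _ <= _ * X]normrM.
rewrite [X in _ <= _ * (X * _)]normrM !normk (gtr0_norm (expR_gt0 _)).
rewrite [leRHS]mulrA ler_wpM2r//.
have -> : (s - x) ^+ 2 * (a ^+ k.+2 * expR (- a * s0)) =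
    a ^+ k * ((- a * s - - a * x) ^+ 2 * expR (- a * s0)).
  by rewrite !exprS; ring.
by rewrite ler_wpM2l// exprn_ge0// ltW.
Qed.

Lemma decayE (tau : R) (n : nat) : 0 <= tau ->
  decay 0 tau n = expR (- alpha n * tau) * delta0 n.
Proof.
by move=> tau0; rewrite to_ell2E ?decay_seq0_Lfun// /decay_seq expr0 mul1r.
Qed.

Lemma decay0 : decay 0 0 = delta0.
Proof.
by apply/LfuneqP => n; rewrite -[LHS]/(ell2_fun _ n) decayE// mulr0 expR0 mul1r.
Qed.

(** The equation is coordinatewise, so the Taylor constant may depend on [n]; this covers [tau = 0]
    for arbitrary data in [ell2]. *)
Lemma decay_solution : global_solution alpha delta0 (decay 0).
Proof.
split=> [|n tau tau0]; first exact: decay0.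
apply: (@has_derive_within_quadratic _ _ _ _ _ (alpha n ^+ 2 * `|delta0 n|)).
apply: filterE => s /=; rewrite in_itv/= andbT => s0.
rewrite !decayE//; set a := alpha n; have a0 : 0 < a := alpha_gt0 n.
have le1 := expR_decay_le1 n.
have := expR_taylor1_le _ _ _ (le1 _ tau0) (le1 _ s0); rewrite mulr1 => h.
rewrite -[(_ - _) *: _]/((s - tau) * _).
have -> : expR (- a * s) * delta0 n - expR (- a * tau) * delta0 n -
    (s - tau) * (- a * (expR (- a * tau) * delta0 n)) =
    (expR (- a * s) - expR (- a * tau) -
      (- a * s - - a * tau) * expR (- a * tau)) * delta0 n by ring.
rewrite normrM mulrAC ler_wpM2r//; apply: le_trans h _.
by rewrite -mulrBr exprMn sqrrN.
Qed.

(** The finitely many modes below [N] are Lipschitz in time, and each remaining mode moves by at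
    most [|delta0 n|]. *)
Lemma decay_cauchy (N : nat) :
  exists C : R, forall s x, 0 <= s -> 0 <= x ->
    `|decay 0 s - decay 0 x| <=
      `|s - x| * C + `|ell2_tail delta0 N|.
Proof.
pose p n := if (n < N)%N then alpha n * delta0 n else 0.
have pL : p \in L2.
  (* The finite sum is a convenient upper bound for each [alpha n] with [n < N]. *)
  apply: (@Lfun2_dominated _ (\sum_(i < N) alpha i)) (ell2_in_Lfun delta0).
  move=> n; rewrite /p; case: ltnP => nN; last first.
    by rewrite normr0 mulr_ge0// sumr_ge0// => i _; exact: ltW.
  rewrite normrM ler_wpM2r// gtr0_norm// (bigD1 (Ordinal nN))//=.
  by rewrite lerDl; apply: sumr_ge0 => i _; exact: ltW.
exists `|to_ell2 p| => s x s0 x0.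
apply: (@le_trans _ _ `| `|s - x| *: to_ell2 p + ell2_tail delta0 N|);
  last first.
  by rewrite (le_trans (ler_normD _ _))// normrZ normr_id.
rewrite -[leRHS]mul1r; apply: ell2_norm_dominated => // n.
rewrite mul1r !ell2_addE ell2_oppE ell2_scaleE !decayE// to_ell2E//.
rewrite ell2_tailE -mulrBl /p.
have le1 := expR_decay_le1 n.
case: ltnP => nN.
  rewrite addr0 !normrM normr_id mulrA ler_wpM2r//.
  have := expR_sub_le _ _ _ (le1 _ x0) (le1 _ s0).
  by rewrite -mulrBr mulr1 normrM normrN [`|alpha n| * _]mulrC.
(* High modes: both exponentials lie in [0, 1], so their difference has absolute value at most 1. *)
rewrite mulr0 add0r normrM ler_piMl// ler_norml.
have := le1 _ x0; have := le1 _ s0.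
have := expR_ge0 (- alpha n * x); have := expR_ge0 (- alpha n * s).
by lra.
Qed.

Lemma decay_continuous : {within `[0, +oo[, continuous (decay 0)}.
Proof.
apply/subspace_continuousP => x /=; rewrite in_itv/= andbT => x0.
apply/cvgrPdist_le => e e0; rewrite near_withinE.
have e20 : 0 < e / 2 by rewrite divr_gt0.
(* [N] is fixed before [s], because the Lipschitz constant [C] depends on it. *)
have [N tailN] := ell2_tail_small delta0 _ e20.
have [C hC] := decay_cauchy N.
have C0 : 0 < `|C| + 1 by rewrite ltr_pwDr.
near=> s => /=; rewrite in_itv/= andbT => s0.
rewrite (le_trans (hC _ _ x0 s0))// [leRHS]splitr lerD//.
apply: (@le_trans _ _ (`|x - s| * (`|C| + 1))).
  by rewrite ler_wpM2l// (le_trans (ler_norm _))// lerDl.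
rewrite -ler_pdivlMr//.
near: s; apply: cvgr_dist_le; first exact: cvg_id.
by rewrite divr_gt0.
Unshelve. all: by end_near. Qed.

Lemma decay_norm_le (c tau : R) : (forall n, c <= alpha n) -> 0 <= tau ->
  `|decay 0 tau| <= `|delta0| * expR (- c * tau).
Proof.
move=> c_le tau0; rewrite mulrC.
apply: ell2_norm_dominated; first exact: expR_ge0.
move=> n; rewrite decayE// normrM (gtr0_norm (expR_gt0 _)) ler_wpM2r//.
by rewrite ler_expR !mulNr lerN2 ler_wpM2r.
Qed.

(** * Energy estimates and convergence of the amplitudes *)

Lemma energy_term_ge0 (u : ell2 R) (n : nat) : 0 <= alpha n / 2 * u n ^+ 2.
Proof. by rewrite mulr_ge0 ?sqr_ge0// divr_ge0// ltW. Qed.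

(** Squaring doubles each decay rate [alpha n >= c], whence the exponent [-2 * c * tau]. The
    comparison is termwise, so an infinite initial energy is covered. *)
Lemma energy_decay_le (c tau : R) : (forall n, c <= alpha n) -> 0 <= tau ->
  (energy alpha (decay 0 tau) <=
   energy alpha (decay 0 0) * (expR (- 2 * c * tau))%:E)%E.
Proof.
move=> c_le tau0; rewrite muleC /energy -nneseriesZl; last first.
  by move=> n _; rewrite lee_fin energy_term_ge0.
apply: lee_nneseries => [n _ _|n _]; first by rewrite lee_fin energy_term_ge0.
rewrite -EFinM lee_fin [leRHS]mulrCA ler_wpM2l ?divr_ge0 ?(ltW (alpha_gt0 n))//.
rewrite !decayE// mulr0 expR0 mul1r exprMn ler_wpM2r ?sqr_ge0//.
rewrite -expRM_natl ler_expR !mulNr mulrN lerN2 -mulrA.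
by rewrite ler_wpM2l// ler_wpM2r.
Qed.

Lemma energy_decay_fin (tau : R) : 0 < tau ->
  (energy alpha (decay 0 tau) < +oo)%E.
Proof.
move=> tau0; have /Lfun2_countingP fin := ell2_in_Lfun delta0.
(* With [x = alpha n * tau], [2 * x <= expR (2 * x)] gives [alpha n / 2 * expR (- 2 * x) <= (4 *
   tau)^-1]. *)
apply: (@le_lt_trans _ _
  (((4 * tau)^-1)%:E * \sum_(n <oo) (delta0 n ^+ 2)%:E)%E); last first.
  by apply: lte_mul_pinfty => //; rewrite lee_fin invr_ge0 mulr_ge0// ltW.
rewrite -nneseriesZl; last by move=> n _; rewrite lee_fin sqr_ge0.
apply: lee_nneseries => [n _ _|n _]; first by rewrite lee_fin energy_term_ge0.
rewrite -EFinM lee_fin decayE ?(ltW tau0)// exprMn mulrA ler_wpM2r ?sqr_ge0//.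
rewrite -expRM_natl mulNr mulrN expRN ler_pdivrMr ?expR_gt0//.
rewrite ler_pdivlMl ?mulr_gt0//.
have := expR_ge1Dx (2 * (alpha n * tau)); lra.
Qed.

(** One nonzero mode [m] of the data loses energy strictly and the others weakly. Strictness
    survives the summation because the other modes have finite total energy at [t > 0], even if the
    energy at [s] is infinite. *)
Lemma energy_decay_lt (s t : R) : delta0 <> 0 -> 0 <= s -> s < t ->
  (energy alpha (decay 0 t) < energy alpha (decay 0 s))%E.
Proof.
move=> delta0_neq0 s0 st; have t0 := le_lt_trans s0 st.
have [m dm] : exists m, delta0 m != 0.
  apply: contrapT => /forallNP d0; apply: delta0_neq0; apply/LfuneqP => n.
  by have /negP := d0 n; rewrite negbK => /eqP.
have fin := energy_decay_fin t t0.
have expr_lt n : expR (- alpha n * t) < expR (- alpha n * s).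
  by rewrite ltr_expR !mulNr ltrN2 ltr_pM2l.
have term_le n :
    alpha n / 2 * decay 0 t n ^+ 2 <= alpha n / 2 * decay 0 s n ^+ 2.
  rewrite ler_wpM2l ?divr_ge0 ?(ltW (alpha_gt0 n))//.
  rewrite !decayE ?(ltW t0)// !exprMn.
  by rewrite ler_wpM2r ?sqr_ge0// ler_pXn2r ?nnegrE ?expR_ge0// ltW.
move: fin; rewrite /energy.
rewrite !(@nneseriesD1 _ _ m xpredT)//;
  try by move=> k _; rewrite lee_fin energy_term_ge0.
move=> fin; apply: lte_leD.
- rewrite ge0_fin_numE.
    by apply: le_lt_trans fin; rewrite leeDr// lee_fin energy_term_ge0.
  by apply: nneseries_ge0 => k _ _; rewrite lee_fin energy_term_ge0.
- rewrite lte_fin ltr_pM2l ?divr_gt0// !decayE ?(ltW t0)// !exprMn.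
  rewrite ltr_pM2r; last by rewrite lt_def sqrf_eq0 dm sqr_ge0.
  by rewrite ltr_pXn2r ?nnegrE ?expR_ge0.
- apply: lee_nneseries => [n _ _|n _]; first by rewrite lee_fin energy_term_ge0.
  by rewrite lee_fin.
Qed.

Lemma amplitude_decay_cvg (n : nat) :
  amplitude (decay 0) n tau @[tau --> +oo] --> (pi : R).
Proof.
rewrite -[X in _ --> X]addr0; apply: cvgD; first exact: cvg_cst.
rewrite -(mul0r (delta0 n)).
have expcvg : expR (- alpha n * tau) @[tau --> +oo] --> (0 : R).
  under eq_fun do rewrite mulNr.
  apply: (cvg_comp (fun tau => alpha n * tau) (fun x => expR (- x))).
    by apply: gt0_cvgMry => //; exact: cvg_id.
  exact: cvgr_expR.
have : expR (- alpha n * tau) * delta0 n @[tau --> +oo] --> 0 * delta0 n.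
  by apply: cvgM expcvg _; exact: cvg_cst.
apply: cvg_trans; apply: near_eq_cvg.
by near=> tau; rewrite decayE.
Unshelve. all: by end_near. Qed.

End decay.

(** * Uniqueness for the scalar equation *)

(** The integrating factor [expR (a * s)] makes [g] have zero derivative inside []0, t[]; the mean
    value theorem then gives [g t = g 0]. *)
Lemma exp_decay_unique {R : realType} (a : R) (f : R -> R) :
  (forall t, 0 <= t -> has_derive_within `[0, +oo[ f t (- a * f t)) ->
  forall t, 0 <= t -> f t = expR (- a * t) * f 0.
Proof.
move=> df t t0; pose g s := expR (a * s) * f s.
have dg x : x \in `]0, t[ -> is_derive x 1 g 0.
  rewrite in_itv/= => /andP[x0 xt].
  have fx : is_derive x 1 f (- a * f x).
    apply: (@has_derive_within_is_derive _ `[0, +oo[); last exact: df (ltW x0).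
    rewrite /interior; near=> s; rewrite /= in_itv/= andbT ltW//.
    by near: s; exact: lt_nbhsr.
  have ex : is_derive x 1 (fun s => expR (a * s)) (expR (a * x) * a).
    apply: is_derive1_comp.
    by apply: is_derive_eq; rewrite [_ *: _]mulr1.
  apply: (is_derive_eq (is_deriveM ex fx)).
  rewrite -![_ *: _]/(_ * _); ring.
(* At the endpoint 0 continuity comes from the one-sided derivative. *)
have cg : {within `[0, t], continuous g}.
  apply/subspace_continuousP => x /=; rewrite in_itv/= => /andP[x0 xt].
  apply: cvgM.
    apply: cvg_within_filter; apply: continuous_comp.
      by apply: cvgM; [exact: cvg_cst|exact: cvg_id].
    exact: continuous_expR.
  have := has_derive_within_continuous _ _ _ _ _ (df x x0).
  apply: cvg_trans; apply: cvg_app; apply: within_subset => s /=.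
  by rewrite !in_itv/= andbT => /andP[].
have [c _] := MVT_segment t0 dg cg.
rewrite mul0r /g mulr0 expR0 mul1r => /eqP; rewrite subr_eq0 => /eqP <-.
by rewrite mulrA -expRD -mulrDl addNr mul0r expR0 mul1r.
Unshelve. all: by end_near. Qed.


Theorem theorem1 (R : realType) (alpha : nat -> R) (delta0 : ell2 R)
    (alpha_gt0 : forall n, 0 < alpha n)
    (inf_alpha_gt0 : 0 < inf (range alpha)) :
  exists delta : R -> ell2 R,
    global_solution alpha delta0 delta /\
    (forall delta' : R -> ell2 R, global_solution alpha delta0 delta' ->
       forall tau, 0 <= tau -> delta' tau = delta tau) /\
    {within `[0, +oo[, continuous delta} /\
    smooth_on `]0, +oo[ delta /\
    (smooth_data alpha delta0 -> smooth_on `[0, +oo[ delta) /\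
    (forall n, amplitude delta n tau @[tau --> +oo] --> (pi : R)) /\
    exponentially_to_0 delta /\
    (delta0 <> 0 -> forall s t, 0 <= s -> s < t ->
       (energy alpha (delta t) < energy alpha (delta s))%E) /\
    (forall tau, 0 <= tau ->
       (energy alpha (delta tau) <=
        energy alpha (delta 0%R) * (expR (- 2 * inf (range alpha) * tau))%:E)%E).
Proof.
(* The infimum is a genuine lower bound because the range is bounded below by 0. *)
have inf_le n : inf (range alpha) <= alpha n.
  apply: ge_inf; last by exists n.
  by exists 0 => _ [m _ <-]; exact: ltW.
exists (decay alpha delta0 0); split; first exact: decay_solution.
split.
  move=> delta' [delta'0 ddelta'] tau tau0; apply/LfuneqP => n.
  rewrite -[RHS]/(ell2_fun _ n) decayE//.
  have := exp_decay_unique (alpha n) (fun s => delta' s n).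
  by rewrite delta'0; apply => // t; exact: ddelta'.
split; first exact: decay_continuous.
split.
  exists (decay alpha delta0); split=> // k x /=; rewrite in_itv/= andbT => x0.
  (* The base time [x / 2] is positive, so all derivatives there lie in [ell2], and it stays to the
     left of every [s] near [x]. *)
  apply: (@decay_has_derive _ _ _ _ _ (x / 2)) => //.
  - by move=> j s xs; apply: decay_seq_Lfun => //; apply: lt_le_trans xs; lra.
  - lra.
  - near=> s => _; near: s; apply: lt_le_nbhsr; lra.
split.
  move=> data.
  exists (decay alpha delta0); split=> // k x /=; rewrite in_itv/= andbT => x0.
  (* Smooth data allow the base time 0, which includes the endpoint [x = 0]. *)
  apply: (@decay_has_derive _ _ _ _ _ 0) => //.
  - by move=> j s s0; exact: decay_seq_Lfun_data.
  - by apply: filterE => s /=; rewrite in_itv/= andbT.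
split; first by move=> n; exact: amplitude_decay_cvg.
split.
  exists `|delta0|, (inf (range alpha)); split=> // tau tau0.
  exact: decay_norm_le.
by split=> *; [exact: energy_decay_lt|exact: energy_decay_le].
Unshelve. all: by end_near. Qed.
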